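(* Let $S\subseteq\mathbb{R}$. Then the following are equivalent: (a) $S$ is compact. (b) ${}^*S\subseteq\mu(S)$. (c) ${}^*S\subseteq\bigcup_{s\in S}\mu(s)$.
   Context: $\mathbb{R}_+$ is the set of positive real numbers and $\mathbb{N}=\{1,2,3,\dots\}$. Fix an ultrafilter $\mathcal{U}$ on $\mathbb{R}_+$ such that $(0,\tfrac1n)\in\mathcal{U}$ for all $n\in\mathbb{N}$. A property of $\varepsilon\in\mathbb{R}_+$ holds almost everywhere (a.e.) if the set of $\varepsilon$ for which it holds belongs to $\mathcal{U}$. For nets $(a_\varepsilon),(b_\varepsilon)\in\mathbb{C}^{\mathbb{R}_+}$ write $(a_\varepsilon)\sim(b_\varepsilon)$ if $a_\varepsilon=b_\varepsilon$ a.e.; $\langle a_\varepsilon\rangle$ is the equivalence class, and ${}^*\mathbb{C}=\mathbb{C}^{\mathbb{R}_+}/\!\sim$ with operations induced pointwise; $\mathbb{C}$ is embedded via constant nets. For $S\subseteq\mathbb{C}$, ${}^*S=\{\langle s_\varepsilon\rangle : s_\varepsilon\in S\text{ a.e.}\}$; in particular this defines ${}^*\mathbb{R}$, ordered by $\langle a_\varepsilon\rangle<\langle b_\varepsilon\rangle$ iff $a_\varepsilon<b_\varepsilon$ a.e. $\mathcal{I}({}^*\mathbb{R})=\{x\in{}^*\mathbb{R}: |x|<\tfrac1n\ \forall n\in\mathbb{N}\}$ is the set of infinitesimals. For $s\in\mathbb{R}$, $\mu(s)=\{s+dx: dx\in\mathcal{I}({}^*\mathbb{R})\}$; for $S\subseteq\mathbb{R}$,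 $\mu(S)=\{s+dx: s\in S,\ dx\in\mathcal{I}({}^*\mathbb{R})\}$. Compactness is with respect to the usual topology of $\mathbb{R}$ (equivalently, closed and bounded). *)

(* Defs.v *)
From HB Require Import structures.
From mathcomp Require Import all_boot all_order all_algebra generic_quotient.
From mathcomp Require Import all_classical all_reals all_analysis.
From mathcomp Require Import complex.

Set Implicit Arguments.
Unset Strict Implicit.
Unset Printing Implicit Defensive.

Import Order.TTheory GRing.Theory Num.Theory.
Import numFieldNormedType.Exports.

Local Open Scope classical_set_scope.
Local Open Scope ring_scope.
Local Open Scope quotient_scope.
Local Open Scope complex_scope.

Section Ultrapower.
Context (R : realType) (U : set_system {posnum R}) {UF : UltraFilter U}.

Local Notation net := ({posnum R} -> R[i]).

Definition eq_ae (a b : net) : bool := `[< \forall e \near U, a e = b e >].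

Lemma eq_ae_refl : reflexive eq_ae.
Proof. by move=> a; apply/asboolP; apply: filterE. Qed.

Lemma eq_ae_sym : symmetric eq_ae.
Proof.
by move=> a b; apply/asboolP/asboolP; apply: filterS => e ->.
Qed.

Lemma eq_ae_trans : transitive eq_ae.
Proof.
move=> b a c /asboolP ab /asboolP bc; apply/asboolP.
by apply: filterS2 ab bc => e -> ->.
Qed.

Canonical eq_ae_equiv := EquivRel eq_ae eq_ae_refl eq_ae_sym eq_ae_trans.

Definition hypC := {eq_quot eq_ae_equiv}.

HB.instance Definition _ := Choice.on hypC.
HB.instance Definition _ := Quotient.on hypC.
HB.instance Definition _ : EqQuotient _ eq_ae_equiv hypC := EqQuotient.on hypC.

Definition hyp_class (a : net) : hypC := \pi_hypC a.

Lemma hyp_classP (a b : net) :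
  hyp_class a = hyp_class b <-> \forall e \near U, a e = b e.
Proof.
split; first by move=> /eqmodP /= /asboolP.
by move=> ab; apply/eqmodP => /=; apply/asboolP.
Qed.

(* Each operation applies the pointwise one to chosen representatives; the
   lemmas [hyp_..._class] show independence of that choice. *)
Definition hyp_add (x y : hypC) := hyp_class (fun e => repr x e + repr y e).
Definition hyp_opp (x : hypC) := hyp_class (fun e => - repr x e).
Definition hyp_mul (x y : hypC) := hyp_class (fun e => repr x e * repr y e).
Definition hyp_abs (x : hypC) := hyp_class (fun e => `|repr x e|).

Lemma repr_class (a : net) : \forall e \near U, repr (hyp_class a) e = a e.
Proof. by apply/hyp_classP; rewrite /hyp_class reprK. Qed.

Lemma hyp_ind (P : hypC -> Prop) : (forall a, P (hyp_class a)) -> forall x, P x.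
Proof. by move=> h x; rewrite -[x]reprK; apply: h. Qed.

Lemma hyp_add_class a b :
  hyp_add (hyp_class a) (hyp_class b) = hyp_class (fun e => a e + b e).
Proof.
by apply/hyp_classP; apply: filterS2 (repr_class a) (repr_class b) => e -> ->.
Qed.

Lemma hyp_opp_class a : hyp_opp (hyp_class a) = hyp_class (fun e => - a e).
Proof. by apply/hyp_classP; apply: filterS (repr_class a) => e ->. Qed.

Lemma hyp_mul_class a b :
  hyp_mul (hyp_class a) (hyp_class b) = hyp_class (fun e => a e * b e).
Proof.
by apply/hyp_classP; apply: filterS2 (repr_class a) (repr_class b) => e -> ->.
Qed.

Lemma hyp_abs_class a : hyp_abs (hyp_class a) = hyp_class (fun e => `|a e|).
Proof. by apply/hyp_classP; apply: filterS (repr_class a) => e ->. Qed.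

Definition hyp_const (c : R[i]) : hypC := hyp_class (fun=> c).

Local Ltac pointwise lem :=
  rewrite /hyp_const ?(hyp_add_class, hyp_opp_class, hyp_mul_class);
  apply/hyp_classP; apply: filterE => e; exact: lem.

Lemma hyp_addA : associative hyp_add.
Proof. by elim/hyp_ind=> a; elim/hyp_ind=> b; elim/hyp_ind=> c; pointwise addrA. Qed.
Lemma hyp_addC : commutative hyp_add.
Proof. by elim/hyp_ind=> a; elim/hyp_ind=> b; pointwise addrC. Qed.
Lemma hyp_add0 : left_id (hyp_const 0) hyp_add.
Proof. by elim/hyp_ind=> a; pointwise add0r. Qed.
Lemma hyp_addN : left_inverse (hyp_const 0) hyp_opp hyp_add.
Proof. by elim/hyp_ind=> a; pointwise addNr. Qed.
Lemma hyp_mulA : associative hyp_mul.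
Proof. by elim/hyp_ind=> a; elim/hyp_ind=> b; elim/hyp_ind=> c; pointwise mulrA. Qed.
Lemma hyp_mulC : commutative hyp_mul.
Proof. by elim/hyp_ind=> a; elim/hyp_ind=> b; pointwise mulrC. Qed.
Lemma hyp_mul1 : left_id (hyp_const 1) hyp_mul.
Proof. by elim/hyp_ind=> a; pointwise mul1r. Qed.
Lemma hyp_mulD : left_distributive hyp_mul hyp_add.
Proof. by elim/hyp_ind=> a; elim/hyp_ind=> b; elim/hyp_ind=> c; pointwise mulrDl. Qed.
Lemma hyp_1neq0 : hyp_const 1 != hyp_const 0.
Proof.
apply/eqP => /hyp_classP h; have [e /eqP] := filter_ex h.
by rewrite oner_eq0.
Qed.

HB.instance Definition _ :=
  GRing.isZmodule.Build hypC hyp_addA hyp_addC hyp_add0 hyp_addN.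
HB.instance Definition _ :=
  GRing.Zmodule_isComNzRing.Build hypC
    hyp_mulA hyp_mulC hyp_mul1 hyp_mulD hyp_1neq0.

Definition star (S : set R[i]) : set hypC :=
  [set x | exists2 s : net, x = hyp_class s & \forall e \near U, S (s e)].

Definition RtoC (S : set R) : set R[i] := [set s%:C | s in S].

Definition hypR : set hypC := star (RtoC setT).

(* On R[i], [<] is the partial order comparing real parts of numbers with equal
   imaginary parts; hence [hyp_lt] is the usual order when x and y are in hypR,
   the only case in which it is used. *)
Definition hyp_lt (x y : hypC) : Prop :=
  exists a b : net, [/\ x = hyp_class a, y = hyp_class b
                      & \forall e \near U, a e < b e].

Definition infinitesimal : set hypC :=
  [set x | hypR x /\
     forall n : nat, (0 < n)%N -> hyp_lt (hyp_abs x) (hyp_const n%:R^-1)].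

Definition monad (s : R) : set hypC :=
  [set hyp_const s%:C + dx | dx in infinitesimal].

Definition monad_set (S : set R) : set hypC :=
  [set x | exists s dx, [/\ S s, infinitesimal dx & x = hyp_const s%:C + dx]].

End Ultrapower.

Arguments hypC {R} U {UF}.
Arguments star {R} U {UF} S.
Arguments hypR {R} U {UF}.
Arguments infinitesimal {R} U {UF}.
Arguments monad {R} U {UF} s.
Arguments monad_set {R} U {UF} S.

(* Main.v *)
(* Taking real parts, a point of *S is the class of a net r with values in S
   a.e., and it lies in the monad of p exactly when r converges to p along U.
   Thus (b) says that every such net converges along U to a point of S. If S is
   compact this holds because the image of U under r is an ultrafilter
   containing S. Conversely, a net with |r(e) - p| < e for all e converges to p,
   which gives closedness, and a net with |r(e)| > 1/e for all e does not
   converge, which gives boundedness. *)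
Require Import Defs.
From HB Require Import structures.
From mathcomp Require Import all_boot all_order all_algebra.
From mathcomp Require Import all_classical all_reals all_analysis.
From mathcomp Require Import complex.
Import Order.TTheory GRing.Theory Num.Theory.
Import numFieldNormedType.Exports.
Local Open Scope classical_set_scope.
Local Open Scope ring_scope.

(** For [A] in a finer proper filter [G], [F] contains the preimage of [A] or of its complement; the
    latter would put two disjoint sets in [G]. *)
Lemma fmap_ultra (T V : Type) (f : T -> V) (F : set_system T) :
  UltraFilter F -> UltraFilter (f @ F).
Proof.
move=> FU; split; first exact: fmap_proper_filter.
move=> G GF FG; apply/seteqP; split=> [A GA|]; last exact: FG.
have [//|FC] := in_ultra_setVsetC (f @^-1` A) FU.
have GC : G (~` A) by apply: FG.
by have [x []] := filter_ex (filterI GA GC).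
Qed.

Lemma norm_real_complex (R : rcfType) (x : R) : `|x%:C%C| = `|x|%:C%C.
Proof. by rewrite normc_def /= expr0n addr0 sqrtr_sqr. Qed.

Section Nets.
Context (R : realType) (U : set_system {posnum R}) {UF : UltraFilter U}.
Implicit Types (a b : {posnum R} -> R[i]) (r : {posnum R} -> R) (S : set R).
Local Notation class := (@hyp_class R U UF).

(** Two representatives of one class agree on a set of [U], so the existential in [hyp_lt] can be
    tested on any pair. *)
Lemma hyp_lt_classP a b :
  hyp_lt (class a) (class b) <-> \forall e \near U, a e < b e.
Proof.
split=> [[a' [b' [/hyp_classP aa' /hyp_classP bb' ab]]]|ab]; last first.
  by exists a, b.
apply: filterS3 aa' bb' ab => e -> ->; exact.
Qed.

Lemma hypR_class (x : hypC U) : hypR U x ->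
  exists r, x = class (fun e => (r e)%:C%C).
Proof.
case=> s -> Us; exists (fun e => complex.Re (s e)); apply/hyp_classP.
by apply: filterS Us => e [t _ <-].
Qed.

Lemma infinitesimal_classP r :
  infinitesimal U (class (fun e => (r e)%:C%C)) <-> r @ U --> (0 : R).
Proof.
have normE n : hyp_lt (hyp_abs (class (fun e => (r e)%:C%C)))
    (@hyp_const R U UF n%:R^-1) <-> \forall e \near U, `|r e| < n%:R^-1.
  rewrite hyp_abs_class hyp_lt_classP.
  by split; apply: filterS => e;
    rewrite norm_real_complex -(rmorph_nat (real_complex R)) -fmorphV ltcR.
split=> [[_ rn]|r0].
  apply/cvgr0Pnorm_lt => eps eps0.
  (* This natural number exceeds [eps^-1], so its inverse lies below [eps]. *)
  have := rn (Num.trunc eps^-1).+1 isT.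
  rewrite normE; apply: filterS => e /lt_trans; apply.
  by rewrite invf_plt ?posrE ?truncnS_gt.
split=> [|n n0].
  by exists (fun e => (r e)%:C%C) => //; apply: filterE => e; exists (r e).
by rewrite normE; move/cvgr0Pnorm_lt: r0; apply; rewrite invr_gt0 ltr0n.
Qed.

Lemma monad_classP r (p : R) :
  monad U p (class (fun e => (r e)%:C%C)) <-> r @ U --> p.
Proof.
split=> [[dx dxI]|rp].
(* Infinitesimals lie in [hypR], so [dx] has a real-valued representative [d]; it tends to 0, and
   [r] is a.e. equal to [p + d]. *)
- have [d dE] := hypR_class _ (proj1 dxI).
  move: dxI; rewrite dE infinitesimal_classP => d0.
  rewrite [_ + _]hyp_add_class => /hyp_classP rE.
  rewrite -[p]addr0.
  apply: cvg_trans (cvgD (cvg_cst p) d0).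
  apply: near_eq_cvg; apply: filterS rE => e.
  by rewrite -rmorphD => /complexI.
- exists (class (fun e => (r e - p)%:C%C)).
    by rewrite infinitesimal_classP; apply/subr_cvg0.
  rewrite [_ + _]hyp_add_class; apply/hyp_classP; apply: filterE => e.
  by rewrite -rmorphD addrC subrK.
Qed.

Lemma monad_setE S : monad_set U S = \bigcup_(s in S) monad U s.
Proof.
apply/seteqP; split=> x.
  by case=> s [dx [Ss dxI ->]]; exists s => //; exists dx.
by case=> s Ss [dx dxI <-]; exists s, dx.
Qed.

Lemma star_sub_monadP S : star U (RtoC S) `<=` monad_set U S <->
  forall r, (\forall e \near U, S (r e)) -> exists2 p, S p & r @ U --> p.
Proof.
rewrite monad_setE; split=> [SM r Sr|SM x [s -> Us]].
  have [|p Sp /monad_classP rp] := SM (class (fun e => (r e)%:C%C)).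
    by exists (fun e => (r e)%:C%C) => //; apply: filterS Sr => e; exists (r e).
  by exists p.
(* The net [s] takes values in [RtoC S] only a.e.; its real part is real everywhere and has the same
   class. *)
have -> : class s = class (fun e => (complex.Re (s e))%:C%C).
  by apply/hyp_classP; apply: filterS Us => e [t _ <-].
have [|p Sp rp] := SM (fun e => complex.Re (s e)).
  by apply: filterS Us => e [t St <-].
by exists p => //; apply/monad_classP.
Qed.

End Nets.

Theorem theorem3p5p1 (R : realType) (U : set_system {posnum R})
    (UF : UltraFilter U)
    (U0 : forall n : nat, (0 < n)%N -> U [set e : {posnum R} | e%:num < n%:R^-1])
    (S : set R) :
  (compact S <-> star U (RtoC S) `<=` monad_set U S) /\
  (star U (RtoC S) `<=` monad_set U S <->
   star U (RtoC S) `<=` \bigcup_(s in S) monad U s).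
Proof.
split; last by rewrite monad_setE.
rewrite star_sub_monadP; split=> [|SM].
  rewrite compact_ultra => Sc r Sr.
  by have [p [Sp rp]] := Sc _ (fmap_ultra _ _ r _ UF) Sr; exists p.
(* By the archimedean property, the bounds 1/n of [U0] reach below every positive real. *)
have Usmall (eps : R) : 0 < eps -> \forall e \near U, e%:num < eps.
  move=> eps0; apply: filterS (U0 (Num.trunc eps^-1).+1 isT) => e /=.
  by move/lt_trans; apply; rewrite invf_plt ?posrE ?truncnS_gt.
have Sclosed : closed S.
  move=> p Sp.
  have /choice[r rP] (e : {posnum R}) : exists s, S s /\ `|p - s| < e%:num.
    by have [s [Ss ps]] := Sp _ (nbhsx_ballx p e%:num (gt0 e)); exists s.
  (* [SM] only provides some limit [q] in [S]; uniqueness of limits will identify it with [p]. *)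
  have [q Sq rq] := SM r (filterE _ (fun e => proj1 (rP e))).
  suff rp : r @ U --> p by rewrite (norm_cvg_unique rp rq).
  apply/cvgrPdist_lt => eps /Usmall; apply: filterS => e.
  exact: lt_trans (proj2 (rP e)).
have [M SM_le] : exists M, forall s, S s -> `|s| <= M.
  apply: contrapT => unbounded.
  have /choice[r rP] (e : {posnum R}) : exists s, S s /\ e%:num^-1 < `|s|.
    (* Without such an [s], the number [e%:num^-1] would bound [S]. *)
    apply: contrapT => noS; apply: unbounded; exists e%:num^-1 => s Ss.
    by rewrite leNgt; apply/negP => es; apply: noS; exists s.
  have [p _ rp] := SM r (filterE _ (fun e => proj1 (rP e))).
  have rlt : \forall e \near U, `|r e| < `|p| + 1.
    by apply: (cvgr_lt _ (cvg_norm rp)); rewrite ltrDl.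
  have p1 : 0 < `|p| + 1 by rewrite ltr_wpDl.
  (* Below this threshold [e%:num^-1] exceeds [|p| + 1], hence so does [|r e|], against [rlt]; as
     [U] is proper, some [e] satisfies both conditions. *)
  have elt := Usmall (`|p| + 1)^-1 ltac:(by rewrite invr_gt0).
  have [e [re]] := filter_ex (filterI rlt elt).
  apply/negP; rewrite -leNgt invf_ple ?posrE //.
  exact: ltW (lt_trans (proj2 (rP e)) re).
apply: (subclosed_compact Sclosed (@segment_compact _ (- M) M)) => s Ss /=.
by rewrite in_itv /= -ler_norml SM_le.
Qed.
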